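(* Fix integers $1\le i<s\le t\le r$. For $n\ge r$ let $N(n)$ be the maximum of $k^t(\mathcal H)$ over all $s$-graphs $\mathcal H$ on $n$ vertices with $\Delta_i(\mathcal H)\le\binom{r-i}{s-i}$. Then \[N(n)=(1-o(1))\frac{\binom{n}{i}}{\binom{r}{i}}\binom{r}{t}\quad\text{as } n\to\infty.\]
   Context: An $s$-graph is a family of $s$-subsets (edges) of a vertex set. For $|I|=i$, $d_{\mathcal H}(I)$ is the number of edges containing $I$ and $\Delta_i(\mathcal H)=\max_{|I|=i}d_{\mathcal H}(I)$. $k^t(\mathcal H)$ is the number of $t$-sets all of whose $s$-subsets are edges. *)

(* Defs.v *)
From HB Require Import structures.
From mathcomp Require Import all_boot all_order all_algebra.
From mathcomp Require Import all_classical all_reals all_analysis.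

Set Implicit Arguments.
Unset Strict Implicit.
Unset Printing Implicit Defensive.

Definition is_sgraph (n s : nat) (H : {set {set 'I_n}}) : bool :=
  [forall e in H, #|e| == s].

Definition codeg (n : nat) (H : {set {set 'I_n}}) (I : {set 'I_n}) : nat :=
  #|[set e in H | I \subset e]|.

Definition maxcodeg (n i : nat) (H : {set {set 'I_n}}) : nat :=
  \max_(I : {set 'I_n} | #|I| == i) codeg H I.

Definition kt (n s t : nat) (H : {set {set 'I_n}}) : nat :=
  #|[set T : {set 'I_n} | (#|T| == t) &&
      [forall S : {set 'I_n}, ((S \subset T) && (#|S| == s)) ==> (S \in H)]]|.

Definition Nmax (i s t r n : nat) : nat :=
  \max_(H : {set {set 'I_n}} | is_sgraph s H && (maxcodeg i H <= 'C(r - i, s - i)))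
     kt s t H.

(* Main.v *)
Require Import Defs.
From HB Require Import structures.
From mathcomp Require Import all_boot all_order all_algebra.
From mathcomp Require Import all_classical all_reals all_analysis.
From mathcomp Require Import all_fingroup zify ring lra.
Import mathcomp.boot.fintype mathcomp.boot.finset.
Import GRing.Theory Num.Theory numFieldNormedType.Exports.

Set Implicit Arguments.
Unset Strict Implicit.
Unset Printing Implicit Defensive.

(** The upper bound comes from the links of the [i]-sets: each link has at most
    [C(r-i,s-i)] edges, hence by Kruskal-Katona at most [C(r-i,t-i)] cliques of size
    [t-i]; double counting pairs ([i]-set, [t]-clique) finishes.

    The lower bound needs packings of [r]-sets, pairwise meeting in fewer than [i]
    points, that cover almost all [i]-sets (Roedl).  No nibble is iterated: a
    first-moment argument shows that a density below 1 can be improved.  Let [P] be a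
    packing of [m] points covering a proportion [d] of the [i]-sets, and let [q] be
    coprime to [m!].  On [m * q] points, place an independently and randomly permuted copy
    of [P] on the graph of each polynomial of degree less than [i] over [Z/q], and a
    fixed copy of [P] on the graph of each [f + X^i] with [deg f < i].  A block of the
    second kind meets each graph of the first kind in at most [i] points, so its
    [C(r,i)] subsets of size [i] lie on distinct graphs and are all uncovered
    with probability [(1-d)^C(r,i)]; keep the block when they are.  If [p(n)] is the
    maximal size of a packing of [n] points, then [p(n) / n^i] converges to its supremum
    [alpha], so, with [beta] the limit of [d], this gives
    [alpha >= alpha (1 + (1 - beta)^C(r,i))], that is [beta = 1]. *)

(** * Cliques in uniform hypergraphs *)

Section Cliques.
Variable T : finType.
Implicit Types (G : {set {set T}}) (I S e : {set T}).

(** Stated over any [finType]; on ['I_n], [#|cliques t s H|] is [kt s t H] by conversion. *)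
Definition cliques (t s : nat) G : {set {set T}} :=
  [set S : {set T} | (#|S| == t) &&
     [forall e : {set T}, ((e \subset S) && (#|e| == s)) ==> (e \in G)]].

Lemma cliquesP t s G S :
  reflect (#|S| = t /\ forall e, e \subset S -> #|e| = s -> e \in G)
          (S \in cliques t s G).
Proof.
rewrite inE; apply: (iffP andP) => [[/eqP St /forallP SG]|[St SG]].
  by split=> // e eS es; have := SG e; rewrite eS es eqxx.
split; first exact/eqP.
by apply/forallP=> e; apply/implyP=> /andP[eS /eqP es]; exact: SG.
Qed.

Definition link I G : {set {set T}} :=
  [set e : {set T} | [disjoint e & I] && (e :|: I \in G)].

Definition star I G : {set {set T}} := [set e in G | I \subset e].

Lemma card_link I G : #|link I G| <= #|star I G|.
Proof.
have inj : {in link I G &, injective (fun e : {set T} => e :|: I)}.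
  move=> e f; rewrite !inE => /andP[eI _] /andP[fI _] /= ef.
  have -> : e = (e :|: I) :\: I by rewrite setDUl setDv setU0; apply/esym/setDidPl.
  by rewrite ef setDUl setDv setU0; apply/setDidPl.
rewrite -(card_in_imset inj); apply/subset_leq_card/subsetP => _ /imsetP[e /[!inE]/andP[_ eG] ->].
by rewrite eG subsetUr.
Qed.

(** Deleting [I] from a clique through it leaves a clique of the link: for each [(s - #|I|)]-subset
    [e] of the rest, [e :|: I] is an [s]-subset of the clique. *)
Lemma card_star_cliques t s I G : #|I| <= s ->
  #|star I (cliques t s G)| <= #|cliques (t - #|I|) (s - #|I|) (link I G)|.
Proof.
move=> Is; have inj : {in star I (cliques t s G) &, injective (fun S : {set T} => S :\: I)}.
  move=> S S' /setIdP[_ IS] /setIdP[_ IS'] /= SS'.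
  by rewrite -(setID S I) -(setID S' I) SS' (setIidPr IS) (setIidPr IS').
rewrite -(card_in_imset inj).
apply/subset_leq_card/subsetP => _ /imsetP[S /setIdP[/cliquesP[St SG] IS] ->].
apply/cliquesP; split=> [|e eS es]; first by rewrite cardsD (setIidPr IS) St.
have eI : [disjoint e & I] by move: eS; rewrite subsetD => /andP[].
rewrite inE eI SG ?subUset ?IS ?andbT //.
  by rewrite (subset_trans eS) ?subsetDl.
by move: eI; rewrite -setI_eq0 cardsU => /eqP->; rewrite cards0 es subn0 subnK.
Qed.

Lemma sum_star (k a : nat) G : {in G, forall e : {set T}, #|e| = k} ->
  \sum_(I : {set T} | #|I| == a) #|star I G| = #|G| * 'C(k, a).
Proof.
move=> Gk; under eq_bigr do rewrite -sum1_card.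
rewrite (exchange_big_dep (mem G)) /=; last by move=> I e _ /setIdP[].
rewrite -sum_nat_const; apply: eq_bigr => e eG.
rewrite sum1dep_card -(Gk e eG) -cards_draws.
by apply: eq_card => I; rewrite !inE eG andbC.
Qed.

Lemma sum_star1 (k : nat) G : {in G, forall e : {set T}, #|e| = k} ->
  \sum_(v : T) #|star [set v] G| = #|G| * k.
Proof.
move=> Gk; under eq_bigr do rewrite -sum1_card.
rewrite (exchange_big_dep (mem G)) /=; last by move=> I e _ /setIdP[].
rewrite -sum_nat_const; apply: eq_bigr => e eG.
rewrite sum1dep_card -(Gk e eG).
by apply: eq_card => v; rewrite !inE eG sub1set.
Qed.

End Cliques.

(* Keevash's proof of Kruskal-Katona for an integer [x].  A clique on [k+1] points at
   [v] yields both an edge avoiding [v] and a clique in the link of [v]: the first bound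
   is used when [v] has large degree, the second (by induction) otherwise. *)
Lemma card_cliquesS (T : finType) k : forall x (G : {set {set T}}),
  0 < k -> k <= x -> {in G, forall e : {set T}, #|e| = k} -> #|G| <= 'C(x, k) ->
  k.+1 * #|cliques k.+1 k G| <= (x - k) * #|G|.
Proof.
elim: k => [//|k IHk] x G _ kx Gk Gx.
have Kk : {in cliques k.+2 k.+1 G, forall S : {set T}, #|S| = k.+2}.
  by move=> S /cliquesP[].
case: k => [|k] in IHk kx Gk Gx Kk *.
  rewrite bin1 in Gx.
  (* Base case of singletons: a clique is a pair inside [cover G], which has at most [#|G| <= x]
     points. *)
  have cov : cliques 2 1 G \subset [set S : {set T} | S \subset cover G & #|S| == 2].
    apply/subsetP=> S /cliquesP[S2 SG]; rewrite inE S2 eqxx andbT.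
    apply/subsetP=> v vS; apply/bigcupP; exists [set v]; last exact: set11.
    by apply: SG; rewrite ?sub1set ?cards1.
  apply: (@leq_trans (2 * 'C(#|cover G|, 2))).
    by rewrite leq_mul2l -cards_draws subset_leq_card.
  have cG : #|cover G| <= #|G|.
    apply: leq_trans (leq_card_cover G) _; rewrite (eq_bigr (fun=> 1)) ?sum1_card //.
  rewrite mul_bin_left bin1; apply: leq_mul => //.
  by apply: leq_sub2r; apply: leq_trans Gx.
(* After multiplication by [k.+2] both sides become sums over vertices, compared at each [v]
   separately. *)
rewrite -(leq_pmul2l (ltn0Sn k.+1)) mulnCA.
have -> : k.+3 * (k.+2 * #|cliques k.+3 k.+2 G|)
        = \sum_(v : T) k.+2 * #|star [set v] (cliques k.+3 k.+2 G)|.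
  by rewrite -big_distrr /= (sum_star1 Kk) mulnCA [X in _ * X = _]mulnC.
have -> : k.+2 * ((x - k.+2) * #|G|)
        = \sum_(v : T) (x - k.+2) * #|star [set v] G|.
  by rewrite -big_distrr /= (sum_star1 Gk) mulnCA [X in _ * X = _]mulnC.
apply: leq_sum => v _.
case: x kx Gx => // x kx Gx.
(* [x] is now the former [x] minus one. Up to this threshold the induction hypothesis applies to the
   link of [v]. *)
case: (leqP #|star [set v] G| 'C(x, k.+1)) => dv.
  have Lk : {in link [set v] G, forall e : {set T}, #|e| = k.+1}.
    move=> e; rewrite inE => /andP[ev /Gk].
    move: ev; rewrite -setI_eq0 cardsU => /eqP->.
    by rewrite cards0 cards1; lia.
  have Lx := leq_trans (card_link [set v] G) dv.
  have := IHk x _ isT kx Lk Lx => IH.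
  have := @card_star_cliques T k.+3 k.+2 [set v] G; rewrite cards1 => /(_ isT).
  rewrite !subn1 /= => cS; apply: leq_trans (leq_mul (leqnn _) cS) _.
  apply: leq_trans IH _; rewrite subSS leq_mul //; exact: card_link.
have Kv : #|star [set v] (cliques k.+3 k.+2 G)| + #|star [set v] G| <= #|G|.
  have inj : {in star [set v] (cliques k.+3 k.+2 G) &, injective (fun S : {set T} => S :\ v)}.
    move=> S S' /setIdP[_]; rewrite sub1set => vS /setIdP[_]; rewrite sub1set => vS' /= SS'.
    by rewrite -(setD1K vS) -(setD1K vS') SS'.
  rewrite -(card_in_imset inj) -(cardsID (star [set v] G) G) addnC leq_add //.
    by apply/subset_leq_card/subsetP => e; rewrite !inE => /andP[-> ->].
  apply/subset_leq_card/subsetP => _ /imsetP[S /setIdP[/cliquesP[S3 SG] vS] ->].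
  rewrite sub1set in vS; rewrite !inE sub1set setD11 andbF /=.
  by apply: SG; rewrite ?subD1set //; have := cardsD1 v S; rewrite vS S3; lia.
(* Above the threshold, [k.+2 * #|G| <= x.+1 * 'C(x, k.+1)] is at most [x.+1] times the degree of
   [v]; combine with [Kv]. *)
have := mul_bin_diag x.+1 k.+1; rewrite /= => mb.
rewrite mulnBl -(leq_add2r (k.+2 * #|star [set v] G|)) subnK ?leq_mul // -mulnDr.
apply: leq_trans (leq_mul (leqnn _) (leq_trans Kv Gx)) _.
by rewrite -mb leq_mul // ltnW.
Qed.

(** Induction on the clique size [k]: a [k.+1]-clique of [G] is also one of the family of
    [k]-cliques of [G], so the one-step bound and [k.+1 * 'C(x, k.+1) = (x - k) * 'C(x, k)]
    apply. *)
Lemma card_cliques (T : finType) a b x (G : {set {set T}}) :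
  0 < b -> b <= a -> a <= x -> {in G, forall e : {set T}, #|e| = b} -> #|G| <= 'C(x, b) ->
  #|cliques a b G| <= 'C(x, a).
Proof.
move=> b0 /subnK <-; elim: (a - b) => [|d IHd] ax Gb Gx.
  rewrite add0n; apply: leq_trans Gx; apply/subset_leq_card/subsetP => S.
  by case/cliquesP => Sb; apply.
have {}IHd := IHd (ltnW ax) Gb Gx; rewrite addSn in ax *.
have sub : cliques (d + b).+1 b G \subset
           cliques (d + b).+1 (d + b) (cliques (d + b) b G).
  apply/subsetP => S /cliquesP[St SG]; apply/cliquesP; split=> // e eS ed.
  by apply/cliquesP; split=> // e' e'e; apply: SG; exact: subset_trans eS.
have K1 : {in cliques (d + b) b G, forall S : {set T}, #|S| = d + b} by move=> S /cliquesP[].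
have := card_cliquesS (ltn_addl d b0) (ltnW ax) K1 IHd.
have := mul_bin_left x (d + b).
have := subset_leq_card sub.
set A := #|_|; set B := #|_|; set C := #|cliques _ _ _|.
move=> AB mb BC.
rewrite -(leq_pmul2l (ltn0Sn (d + b))) mb.
by apply: leq_trans (leq_mul (leqnn _) AB) _; apply: leq_trans BC _; rewrite leq_mul2l IHd orbT.
Qed.

(** * Packings *)

(** [L C] lists [C] first and its complement after; the permutation matches [L A] with [L B]
    position by position. *)
Lemma exists_perm_imset (T : finType) (A B : {set T}) :
  #|A| = #|B| -> exists s : {perm T}, s @: A = B.
Proof.
move=> AB; pose L (C : {set T}) := enum C ++ enum (~: C).
have LT C x : x \in L C by rewrite mem_cat !mem_enum inE orbN.
have LU C : uniq (L C).
  rewrite cat_uniq !enum_uniq /= andbT; apply/hasPn => x.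
  by rewrite !mem_enum inE.
have LS C : size (L C) = #|T| by rewrite size_cat -!cardE cardsC.
pose f x := nth x (L B) (index x (L A)).
have fE x0 x : f x = nth x0 (L B) (index x (L A)).
  by apply: set_nth_default; rewrite LS -(LS A) index_mem.
have finj : injective f.
  move=> x y; rewrite (fE x) (fE x y) => /eqP; rewrite nth_uniq ?LS -?(LS A) ?index_mem //.
  by move/eqP; apply: index_inj.
exists (perm finj); apply/eqP; rewrite eqEcard card_imset ?AB ?leqnn ?andbT; last exact: perm_inj.
apply/subsetP => _ /imsetP[x xA ->]; rewrite permE /f index_cat mem_enum xA nth_cat.
by rewrite -cardE -AB cardE index_mem mem_enum xA -(mem_enum B) mem_nth // -cardE -AB cardE index_mem mem_enum.
Qed.

Section Packings.
Variables (i r : nat).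
Implicit Type T : finType.

(** A partial Steiner system: each [i]-set lies in at most one block. *)
Definition packing T (P : {set {set T}}) : bool :=
  [forall B in P, #|B| == r] &&
  [forall B in P, forall B' in P, (B != B') ==> (#|B :&: B'| < i)].

Lemma packingP T (P : {set {set T}}) :
  reflect ({in P, forall B : {set T}, #|B| = r} /\
           {in P &, forall B B' : {set T}, B != B' -> #|B :&: B'| < i})
          (packing P).
Proof.
apply: (iffP andP) => -[Pr Pi]; split.
- by move=> B BP; apply/eqP; move/forall_inP: Pr; apply.
- move=> B B' BP B'P; move/forall_inP: Pi => /(_ B BP)/forall_inP/(_ B' B'P)/implyP.
  by apply.
- by apply/forall_inP => B /Pr ->.
- by apply/forall_inP => B BP; apply/forall_inP => B' B'P; apply/implyP; exact: Pi.
Qed.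

Definition packing_number (n : nat) : nat :=
  \max_(P : {set {set 'I_n}} | packing P) #|P|.

(** Lets blocks be indexed by any [X] and drawn on any point type [T]. The indexing is injective
    because equal blocks would meet in [r >= i] points. *)
Lemma packing_number_ge T (X : finType) (D : {set X}) (K : X -> {set T}) n :
  i <= r -> #|T| <= n -> {in D, forall x, #|K x| = r} ->
  {in D &, forall x y, x != y -> #|K x :&: K y| < i} -> #|D| <= packing_number n.
Proof.
move=> ir Tn Kr Ki.
pose g (x : T) : 'I_n := widen_ord Tn (enum_rank x).
have ginj : injective g by move=> x y /(congr1 val)/= /ord_inj/enum_rank_inj.
have Kinj : {in D &, injective (fun x => g @: K x)}.
  move=> x y xD yD /(imset_inj ginj) Kxy; apply/eqP/negPn/negP => xy.
  have := Ki x y xD yD xy; rewrite Kxy setIid (Kr y yD); lia.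
rewrite -(card_in_imset Kinj); apply: (@leq_bigmax_cond _ _ _ [set g @: K x | x in D]).
apply/packingP; split=> [_ /imsetP[x xD ->]|_ _ /imsetP[x xD ->] /imsetP[y yD ->] xy].
  by rewrite card_imset ?Kr.
rewrite -imsetI; last by move=> ? ? _ _; exact: ginj.
by rewrite card_imset //; apply: Ki => //; apply: contraNneq xy => ->.
Qed.

Lemma packing_number_witness n :
  exists2 P : {set {set 'I_n}}, packing P & #|P| = packing_number n.
Proof.
have p0 : packing (set0 : {set {set 'I_n}}).
  by apply/packingP; split=> [B|B B']; rewrite inE.
have : 0 < #|[pred P : {set {set 'I_n}} | packing P]|.
  by apply/card_gt0P; exists set0.
by case/(eq_bigmax_cond (fun P : {set {set 'I_n}} => #|P|)) => P PP PE; exists P.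
Qed.

Lemma card_packing_star T (P : {set {set T}}) (I : {set T}) :
  packing P -> i <= #|I| -> #|star I P| <= 1.
Proof.
move=> /packingP[_ Pi] Ii; apply/card_le1_eqP => B B' /setIdP[BP IB] /setIdP[B'P IB'].
apply/eqP/negPn/negP => BB'; have := Pi _ _ B'P BP BB'.
by rewrite ltnNge (leq_trans Ii) // subset_leq_card // subsetI IB IB'.
Qed.

(** A covered [i]-set lies in exactly one block, so counting incidences counts the covered sets. *)
Lemma packing_uncovered T (P : {set {set T}}) : packing P ->
  #|[set I : {set T} | (#|I| == i) && [forall B in P, ~~ (I \subset B)]]| +
    #|P| * 'C(r, i) = 'C(#|T|, i).
Proof.
move=> PP; have /packingP[Pr _] := PP; rewrite -(sum_star i Pr) -card_draws.
rewrite -sum1dep_card -sum1dep_card [RHS](bigID (fun I : {set T} => [forall B in P, ~~ (I \subset B)])) /=.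
congr (_ + _); rewrite [LHS](bigID (fun I : {set T} => [forall B in P, ~~ (I \subset B)])) /=.
rewrite big1 ?add0n => [|I /andP[_ /forall_inP IP]].
  apply: eq_bigr => I /andP[/eqP Ii /forall_inPn[B BP]]; rewrite negbK => IB.
  apply/eqP; rewrite eqn_leq card_packing_star ?Ii //=.
  by apply/card_gt0P; exists B; rewrite inE BP.
by apply: eq_card0 => B; rewrite inE; apply/negP => /andP[/IP /negPf->].
Qed.

Lemma packing_number_le n : packing_number n * 'C(r, i) <= 'C(n, i).
Proof.
have [P PP <-] := packing_number_witness n.
by have := packing_uncovered PP; rewrite card_ord; lia.
Qed.

(* By transitivity of the symmetric group on [i]-sets, each of them is left uncovered by
   the same number of permuted copies of [P]. *)
Lemma card_perm_uncovered T (P : {set {set T}}) (J : {set T}) :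
  packing P -> #|J| = i ->
  #|[set s : {perm T} | [forall B in P, ~~ (J \subset s @: B)]]| * 'C(#|T|, i)
    = #|{perm T}| * ('C(#|T|, i) - #|P| * 'C(r, i)).
Proof.
move=> PP Ji; rewrite -[in RHS](packing_uncovered PP) addnK.
pose N (I : {set T}) := #|[set s : {perm T} | [forall B in P, ~~ (I \subset s @: B)]]|.
have NE (I : {set T}) : #|I| == i -> N I = N J.
  move/eqP=> Ii; have [u uI] : exists u : {perm T}, u @: I = J by apply: exists_perm_imset; rewrite Ii.
  (* Right multiplication by [u] carries the permutations counted by [N I] onto those counted by
     [N J]. *)
  rewrite /N -(card_imset _ (@mulIg _ u)); apply: eq_card => s.
  rewrite inE; apply/imsetP/idP => [[t]|]; rewrite ?inE => H.
    move=> ->; apply/forall_inP => B BP; move/forall_inP: H => /(_ B BP).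
    apply: contra; rewrite -uI => /subsetP sub; apply/subsetP => x xI.
    have /imsetP[y yB] : u x \in (t * u)%g @: B by apply: sub; rewrite imset_f.
    by rewrite permM => /perm_inj->; rewrite imset_f.
  exists (s * u^-1)%g; last by rewrite mulgKV.
  rewrite inE; apply/forall_inP => B BP; move/forall_inP: H => /(_ B BP).
  apply: contra; rewrite -uI => /subsetP sub; apply/subsetP => _ /imsetP[x /sub xI ->].
  by move/imsetP: xI => [y yB ->]; rewrite permM permKV imset_f.
(* Sum [N] over all [i]-sets and exchange: each [s] maps the [i]-sets missed by [P] bijectively onto
   those missed by its copy. *)
rewrite -/(N J) mulnC -card_draws -sum_nat_const.
under eq_bigl do rewrite inE.
rewrite -(eq_bigr _ NE) /N.
under eq_bigr do rewrite -sum1dep_card.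
rewrite (exchange_big_dep predT) //= -[RHS]sum_nat_const; apply: eq_bigr => s _.
rewrite sum1dep_card.
rewrite -[RHS](card_imset _ (imset_inj (@perm_inj _ s))); apply: eq_card => I.
rewrite inE; apply/idP/imsetP => [/andP[/eqP Ii IP]|[I' I'P ->]].
  have sI : I = s @: (s^-1%g @: I).
    by rewrite -imset_comp -[LHS]imset_id; apply: eq_imset => x /=; rewrite permKV.
  exists (s^-1%g @: I) => //; rewrite inE card_imset ?Ii ?eqxx; last exact: perm_inj.
  apply/forall_inP => B BP; move/forall_inP: IP => /(_ B BP).
  by apply: contra => sub; rewrite sI imsetS.
move: I'P; rewrite inE => /andP[/eqP I'i /forall_inP I'P].
rewrite card_imset ?I'i ?eqxx /=; last exact: perm_inj.
apply/forall_inP => B /I'P; apply: contra => /subsetP sub; apply/subsetP => x xI.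
have /imsetP[y yB /perm_inj->//] : s x \in s @: B by apply: sub; rewrite imset_f.
Qed.

End Packings.

(** * Random amplification *)

Definition graph_over (A V : finType) (e : A -> V) (B : {set A}) : {set A * V} :=
  [set (a, e a) | a in B].

Lemma card_graph_over (A V : finType) (e : A -> V) (B : {set A}) :
  #|graph_over e B| = #|B|.
Proof. by apply: card_imset => a b []. Qed.

Definition agree (A V : finType) (e e' : A -> V) : {set A} := [set a | e a == e' a].

Lemma agreexx (A V : finType) (e : A -> V) : agree e e = setT.
Proof. by apply/setP => a; rewrite !inE eqxx. Qed.

Lemma card_graph_overI (A V : finType) (e e' : A -> V) (B B' : {set A}) :
  #|graph_over e B :&: graph_over e' B'| = #|B :&: B' :&: agree e e'|.
Proof.
rewrite -(card_graph_over e); apply: eq_card => -[a v].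
rewrite !inE; apply/andP/imsetP => [[/imsetP[b bB [-> ->]] /imsetP[c cB [bc ec]]]|[b]].
  by exists b => //; rewrite !inE bB ec bc eqxx cB.
rewrite !inE => /andP[/andP[bB bB'] /eqP ebe] [-> ->]; split; apply/imsetP; exists b => //.
by rewrite ebe.
Qed.

Section Amplification.
Variables (i r : nat) (A V F : finType) (ev ev' : F -> A -> V) (P : {set {set A}}).
Hypothesis ir : i <= r.
Hypothesis evP : forall f g, f != g -> #|agree (ev f) (ev g)| < i.
Hypothesis evP' : forall f g, f != g -> #|agree (ev' f) (ev' g)| < i.
Hypothesis evev' : forall f g, #|agree (ev f) (ev' g)| <= i.
Hypothesis PP : packing i r P.

(** When [W > 0], [U / W] is the probability that a randomly permuted copy of [P] misses a given
    [i]-set. *)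
Let W := 'C(#|A|, i).
Let U := W - #|P| * 'C(r, i).

Definition avoids (f g : F) (B' : {set A}) : {set {perm A}} :=
  [set s : {perm A} | [forall B in P, #|(s @: B) :&: B' :&: agree (ev f) (ev' g)| < i]].

Definition avoiding (g : F) (B' : {set A}) : {set {ffun F -> {perm A}}} :=
  [set s | s \in family (fun f => mem (avoids f g B'))].

(** [inl] indexes blocks of the first kind, all kept; [inr] those of the second kind, kept only when
    they avoid every permuted copy. *)
Definition selected (s : {ffun F -> {perm A}}) : {set F * {set A} + F * {set A}} :=
  [set x | match x with
           | inl y => y.2 \in P
           | inr y => (y.2 \in P) && (s \in avoiding y.1 y.2) end].

Definition lifted (s : {ffun F -> {perm A}}) (x : F * {set A} + F * {set A}) :=
  match x with
  | inl y => graph_over (ev y.1) (s y.1 @: y.2)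
  | inr y => graph_over (ev' y.1) y.2
  end.

(** Blocks on one graph meet as in [P]; on different graphs of one kind [evP] or [evP'] applies;
    opposite kinds are separated by [avoiding]. *)
Lemma card_selected s : #|selected s| <= packing_number i r (#|A| * #|V|).
Proof.
have [Pr Pi] := packingP _ _ _ PP.
have cross f B g B' : inl (f, B) \in selected s -> inr (g, B') \in selected s ->
    #|lifted s (inl (f, B)) :&: lifted s (inr (g, B'))| < i.
  rewrite !inE /= => BP /andP[B'P /familyP/(_ f)].
  rewrite -[_ \in mem _]/(s f \in avoids f g B') inE => /forall_inP/(_ B BP).
  by rewrite card_graph_overI.
apply: (packing_number_ge (K := lifted s)) => //; first by rewrite card_prod.
  move=> [[f B]|[f B]] /=; rewrite !inE /= card_graph_over.
    by move=> BP; rewrite card_imset ?Pr //; exact: perm_inj.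
  by case/andP => BP _; exact: Pr.
move=> [[f B]|[f B]] [[g B']|[g B']] xD yD xy.
- rewrite card_graph_overI /=; have [fg|fg] := eqVneq f g.
    subst g; rewrite -imsetI; last by move=> ? ? _ _; exact: perm_inj.
    rewrite agreexx setIT card_imset; last exact: perm_inj.
    move: xD yD; rewrite !inE /= => BP B'P; apply: Pi => //.
    by apply: contraNneq xy => ->.
  by apply: leq_ltn_trans (evP fg); rewrite subset_leq_card ?subsetIr.
- exact: cross.
- by rewrite setIC; exact: cross.
- rewrite card_graph_overI /=; have [fg|fg] := eqVneq f g.
    subst g; rewrite agreexx setIT.
    move: xD yD; rewrite !inE /= => /andP[BP _] /andP[B'P _]; apply: Pi => //.
    by apply: contraNneq xy => ->.
  by apply: leq_ltn_trans (evP' fg); rewrite subset_leq_card ?subsetIr.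
Qed.

Lemma card_selectedE s :
  #|selected s| = #|F| * #|P| + \sum_(y : F * {set A} | y.2 \in P) (s \in avoiding y.1 y.2).
Proof.
rewrite -sum1_card big_sumType /=; congr (_ + _).
  rewrite -cardsT -cardsX -sum1_card; apply: eq_bigl => -[f B].
  by rewrite !inE.
rewrite [RHS]big_mkcond [LHS]big_mkcond; apply: eq_bigr => -[f B] _.
by rewrite inE; case: (B \in P) => //=; case: (_ \in _).
Qed.

Lemma card_avoiding_prod g B' : #|avoiding g B'| = \prod_(f : F) #|avoids f g B'|.
Proof.
by rewrite cardsE card_family foldrE big_image.
Qed.

Lemma card_avoids_small f g B' :
  #|B' :&: agree (ev f) (ev' g)| != i -> #|avoids f g B'| = #|{perm A}|.
Proof.
move=> Ji; have Ji' : #|B' :&: agree (ev f) (ev' g)| < i.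
  rewrite ltn_neqAle Ji; apply: leq_trans (evev' f g).
  by rewrite subset_leq_card ?subsetIr.
rewrite -cardsT; apply: eq_card => s; rewrite !inE; apply/forall_inP => B _.
by apply: leq_ltn_trans Ji'; rewrite subset_leq_card // -setIA subsetIr.
Qed.

Lemma card_avoids_tight f g B' :
  #|B' :&: agree (ev f) (ev' g)| = i -> #|avoids f g B'| * W = #|{perm A}| * U.
Proof.
move=> Ji; rewrite -(card_perm_uncovered PP Ji); congr (_ * _); apply: eq_card => s.
rewrite !inE; apply: eq_forallb => B; congr (_ ==> _).
rewrite -setIA ltnNge -[in X in X <= _]Ji; congr (~~ _).
apply/idP/setIidPr => [JB|-> //].
by apply/eqP; rewrite eqEcard subsetIr.
Qed.

(** The survival probability of a block of the second kind, with denominators cleared: only the [f]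
    that agree with it in exactly [i] points impose a condition, each of probability [U / W]. *)
Lemma card_avoiding g B' : B' \in P ->
  #|{perm A}| ^ #|F| * U ^ 'C(r, i) <= #|avoiding g B'| * W ^ 'C(r, i).
Proof.
move=> B'P; pose J f := B' :&: agree (ev f) (ev' g).
pose k := #|[set f | #|J f| == i]|.
have kC : k <= 'C(r, i).
  have [Pr _] := packingP _ _ _ PP; rewrite -(Pr _ B'P) -cards_draws.
  (* Equal agreement sets would make [ev f] and [ev f'] coincide on [i] points, against [evP]. *)
  have Jinj : {in [set f | #|J f| == i] &, injective J}.
    move=> f f' /[!inE]/eqP Jf _ ff'; apply/eqP/negPn/negP => /evP.
    rewrite ltnNge -[X in X <= _]Jf => /negP; apply; apply: subset_leq_card.
    apply/subsetP => a aJ; have := aJ; rewrite ff'.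
    by move: aJ; rewrite !inE => /andP[_ /eqP->] /andP[_ /eqP->].
  rewrite /k -(card_in_imset Jinj); apply: subset_leq_card.
  by apply/subsetP => _ /imsetP[f /[!inE] Jf ->]; rewrite subsetIl.
have UW : U <= W by exact: leq_subr.
rewrite card_avoiding_prod -(subnKC kC) !expnD.
have -> : (\prod_f #|avoids f g B'|) * (W ^ k * W ^ ('C(r, i) - k))
        = #|{perm A}| ^ #|F| * U ^ k * W ^ ('C(r, i) - k).
  rewrite mulnA; congr (_ * _).
  rewrite /k -!prod_nat_const (bigID (fun f => #|J f| == i)) /=.
  rewrite mulnAC; under [X in _ * X * _]eq_bigl do rewrite inE.
  rewrite -big_split /= (eq_bigr (fun=> #|{perm A}| * U)); last by move=> f /eqP/card_avoids_tight.
  rewrite [X in _ * X](eq_bigr (fun=> #|{perm A}|)); last by move=> f /card_avoids_small.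
  rewrite big_split /= mulnAC; congr (_ * _).
    by rewrite [RHS](bigID (fun f => #|J f| == i)).
  by apply: eq_bigl => f; rewrite inE.
(* The remaining factors are compared by [U <= W]; exponent zero is split off because [leq_exp2r]
   wants a positive one. *)
rewrite mulnA leq_mul //; case: (_ - k) => // e.
by rewrite leq_exp2r.
Qed.

(** First moment: the sum of [#|selected s|] over all [s] is bounded above by [card_selected] and
    below by [card_avoiding]. *)
Lemma amplification :
  #|F| * #|P| * (W ^ 'C(r, i) + U ^ 'C(r, i))
    <= packing_number i r (#|A| * #|V|) * W ^ 'C(r, i).
Proof.
set N := packing_number _ _ _; set M := #|{perm A}| ^ #|F|.
have M0 : 0 < M by rewrite expn_gt0; apply/orP; left; apply/card_gt0P; exists 1%g.
have MF : #|{ffun F -> {perm A}}| = M by rewrite card_ffun.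
rewrite -(leq_pmul2l M0).
have sumle : \sum_(s : {ffun F -> {perm A}}) #|selected s| <= M * N.
  rewrite -MF -sum_nat_const; apply: leq_sum => s _; exact: card_selected.
rewrite [leqRHS]mulnA; apply: leq_trans (leq_mul sumle (leqnn _)).
under eq_bigr do rewrite card_selectedE.
rewrite big_split /= sum_nat_const MF mulnDl mulnDr mulnDr.
rewrite [leqRHS]addnC [leqLHS]addnC leq_add //; last by rewrite mulnA.
rewrite exchange_big /= big_distrl /=.
have -> : M * (#|F| * #|P| * U ^ 'C(r, i)) =
          \sum_(y : F * {set A} | y.2 \in P) M * U ^ 'C(r, i).
  rewrite sum_nat_const mulnCA; congr (_ * _).
  by rewrite -cardsT -cardsX; apply: eq_card => -[f B]; rewrite !inE.
apply: leq_sum => -[g B] /= BP; apply: leq_trans (card_avoiding g BP) _.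
rewrite leq_mul // -sum1_card [leqLHS]big_mkcond; apply: leq_sum => s _.
by case: (_ \in _).
Qed.

End Amplification.

(** * Reed-Solomon codes over Z/q *)

(** ['Z_q] may have zero divisors; the usual root bound survives at points whose differences are
    units. *)
Lemma card_roots_unit_diff (R : comUnitRingType) (T : finType) (x : T -> R) (p : {poly R}) :
  (forall a b, a != b -> (x b - x a)%R \is a GRing.unit) -> p != 0%R ->
  #|[set a | root p (x a)]| < size p.
Proof.
move=> xU p0; set S := [set a | _].
have xsu s : uniq s -> uniq_roots (map x s).
  elim: s => //= a s IHs /andP[as_ us]; rewrite IHs // andbT.
  apply/allP => _ /mapP[b bs ->]; rewrite /diff_roots mulrC eqxx /= xU //.
  by apply: contraNneq as_ => ->.
rewrite cardE -(size_map x); apply: max_ring_poly_roots => //; last exact/xsu/enum_uniq.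
by apply/allP => _ /mapP[a + ->]; rewrite mem_enum inE.
Qed.

Section ReedSolomon.
Variables (i m q : nat).
Hypotheses (q1 : 1 < q) (qm : coprime q m`!).

Let pt (a : 'I_m) : 'Z_q := (a : nat)%:R%R.

(** Up to sign the difference is a positive integer below [m], so it divides [m!], which is coprime
    to [q]. *)
Lemma pt_diff_unit (a b : 'I_m) : a != b -> (pt b - pt a)%R \is a GRing.unit.
Proof.
wlog ab : a b / a < b.
  move=> H; rewrite neq_ltn => /orP[ab|ba]; first by apply: H; rewrite // neq_ltn ab.
  by rewrite -opprB unitrN; apply: H; rewrite // neq_ltn ba.
move=> _; rewrite /pt -natrB; last exact: ltnW.
rewrite unitZpE //; apply: coprime_dvdr qm; apply: dvdn_fact.
by have := ltn_ord b; lia.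
Qed.

Definition ffun_poly (f : {ffun 'I_i -> 'Z_q}) : {poly 'Z_q} :=
  (\poly_(k < i) (if insub k is Some j then f j else 0))%R.

(** [c = 0] and [c = 1] give the graphs of the first and second kind. *)
Definition codeword (c : 'Z_q) (f : {ffun 'I_i -> 'Z_q}) (a : 'I_m) : 'Z_q :=
  ((ffun_poly f + c *: 'X^i).[pt a])%R.

Lemma coef_ffun_poly f (j : 'I_i) : ((ffun_poly f)`_j)%R = f j.
Proof. by rewrite coef_poly ltn_ord valK. Qed.

Lemma card_agree_codeword c f g : f != g -> #|agree (codeword c f) (codeword c g)| < i.
Proof.
move=> fg; have pfg : (ffun_poly f - ffun_poly g)%R != 0%R.
  apply: contraNneq fg => /eqP; rewrite subr_eq0 => /eqP pfg.
  by apply/eqP/ffunP => j; rewrite -!coef_ffun_poly pfg.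
have := card_roots_unit_diff pt_diff_unit pfg.
have sz : size (ffun_poly f - ffun_poly g)%R <= i.
  by rewrite (leq_trans (size_polyD _ _)) // size_polyN geq_max !size_poly.
move=> /leq_trans/(_ sz); apply: leq_ltn_trans; apply: subset_leq_card.
apply/subsetP => a; rewrite !inE /codeword !hornerD => /eqP/addIr pa.
by rewrite rootE hornerD hornerN pa subrr.
Qed.

(** The difference of the two polynomials is monic of degree [i]. *)
Lemma card_agree_codeword01 f g : #|agree (codeword 0%R f) (codeword 1%R g)| <= i.
Proof.
have sz : size (ffun_poly g - ffun_poly f)%R < i.+1.
  by rewrite ltnS (leq_trans (size_polyD _ _)) // size_polyN geq_max !size_poly.
have pfg : size ('X^i + (ffun_poly g - ffun_poly f))%R = i.+1 by rewrite size_polyDl size_polyXn.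
have p0 : ('X^i + (ffun_poly g - ffun_poly f))%R != 0%R by rewrite -size_poly_eq0 pfg.
have := card_roots_unit_diff pt_diff_unit p0; rewrite pfg ltnS.
apply: leq_trans; apply: subset_leq_card.
apply/subsetP => a; rewrite !inE /codeword scale0r addr0 scale1r => /eqP pa.
by rewrite rootE addrA [('X^i + _)%R]addrC hornerD hornerN pa subrr.
Qed.

End ReedSolomon.

Lemma packing_number_amplify (i r m q : nat) : i <= r -> 1 < q -> coprime q m`! ->
  q ^ i * packing_number i r m *
      ('C(m, i) ^ 'C(r, i) + ('C(m, i) - packing_number i r m * 'C(r, i)) ^ 'C(r, i))
    <= packing_number i r (m * q) * 'C(m, i) ^ 'C(r, i).
Proof.
move=> ir q1 qm; have [P PP PE] := packing_number_witness i r m.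
have := amplification ir (@card_agree_codeword i m q q1 qm 0%R)
  (@card_agree_codeword i m q q1 qm 1%R) (@card_agree_codeword01 i m q q1 qm) PP.
by rewrite card_ffun !card_ord PE Zp_cast.
Qed.

Lemma leq_packing_number (i r m n : nat) : i <= r -> m <= n ->
  packing_number i r m <= packing_number i r n.
Proof.
move=> ir mn; have [P /packingP[Pr Pi] <-] := packing_number_witness i r m.
by apply: (packing_number_ge (K := id)) => //; rewrite card_ord.
Qed.

(** * Bounds on Nmax *)

Lemma Nmax_upper (i s t r n : nat) : i < s -> s <= t -> t <= r ->
  Nmax i s t r n * 'C(t, i) <= 'C(n, i) * 'C(r - i, t - i).
Proof.
move=> lis st tr.
suff H (H : {set {set 'I_n}}) : is_sgraph s H -> maxcodeg i H <= 'C(r - i, s - i) ->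
    kt s t H * 'C(t, i) <= 'C(n, i) * 'C(r - i, t - i).
  rewrite /Nmax; elim/big_ind : _ => // [x y xN yN|G /andP[Gs GD]]; last exact: H.
  by rewrite /maxn; case: ifP.
move=> /forall_inP Hs HD.
rewrite -[kt s t H]/#|cliques t s H|.
have Kt : {in cliques t s H, forall S : {set 'I_n}, #|S| = t} by move=> S /cliquesP[].
rewrite -(sum_star i Kt) -[in X in _ <= X * _](card_ord n) -card_draws -sum1dep_card big_distrl /=.
apply: leq_sum => I /eqP Ii; rewrite mul1n.
have := @card_star_cliques _ t s I H; rewrite Ii => /(_ (ltnW lis))/leq_trans; apply.
(* The strict inequality [i < s] gives the links the positive uniformity that [card_cliques]
   requires. *)
apply: card_cliques; rewrite ?subn_gt0 ?leq_sub2r //.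
  move=> e; rewrite inE => /andP[eI /Hs /eqP <-].
  by move: eI; rewrite -setI_eq0 cardsU Ii => /eqP->; rewrite cards0 subn0 addnK.
apply: leq_trans (card_link _ _) _; apply: leq_trans HD.
by apply: (@leq_bigmax_cond _ (fun I : {set 'I_n} => #|I| == i) (codeg H)); apply/eqP.
Qed.

(** Take all [s]-subsets of blocks of a maximum packing. The edges through an [i]-set lie in the
    only block containing it, and the [t]-subsets of distinct blocks are distinct cliques. *)
Lemma Nmax_lower (i s t r n : nat) : i < s -> s <= t ->
  packing_number i r n * 'C(r, t) <= Nmax i s t r n.
Proof.
move=> lis st; have [P PP <-] := packing_number_witness i r n.
have [Pr Pi] := packingP _ _ _ PP.
pose H := [set S : {set 'I_n} | (#|S| == s) && [exists B in P, S \subset B]].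
have HN : is_sgraph s H && (maxcodeg i H <= 'C(r - i, s - i)).
  apply/andP; split; first by apply/forall_inP => S; rewrite inE => /andP[].
  apply/bigmax_leqP => I /eqP Ii.
  have [/exists_inP[B BP IB]|/exists_inPn nB] := boolP [exists B in P, I \subset B]; last first.
    rewrite /codeg eq_card0 // => S; rewrite !inE; apply/negP => /andP[/andP[_ /exists_inP[B BP SB]] IS].
    by have := nB B BP; rewrite (subset_trans IS SB).
  have inj : {in [set e in H | I \subset e] &, injective (fun S : {set 'I_n} => S :\: I)}.
    move=> S S' /setIdP[_ IS] /setIdP[_ IS'] /= SS'.
    by rewrite -(setID S I) -(setID S' I) SS' (setIidPr IS) (setIidPr IS').
  rewrite /codeg -(card_in_imset inj).
  have <- : #|B :\: I| = r - i by rewrite cardsD (setIidPr IB) Ii Pr.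
  rewrite -cards_draws; apply/subset_leq_card/subsetP => _ /imsetP[S /setIdP[+ IS] ->].
  rewrite inE => /andP[/eqP Ss /exists_inP[B' B'P SB']].
  have BB' : B' = B.
    have /card_le1_eqP := card_packing_star PP (eq_leq (esym Ii)).
    by apply; rewrite inE ?B'P ?BP //= (subset_trans IS).
  by rewrite inE setSD -?BB' //= cardsD (setIidPr IS) Ss Ii.
rewrite /Nmax; apply: leq_trans (@leq_bigmax_cond _ _ (kt s t) H HN).
rewrite -(sum_star t Pr) -[kt s t H]/#|cliques t s H| -sum1_card.
rewrite big_mkcond [leqRHS]big_mkcond /=; apply: leq_sum => T _.
case: eqP => // Tt; have [/exists_inP[B BP TB]|/exists_inPn nB] := boolP [exists B in P, T \subset B].
  suff -> : T \in cliques t s H by apply: card_packing_star PP _; rewrite Tt; lia.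
  apply/cliquesP; split=> // e eT es; rewrite inE es eqxx /=; apply/exists_inP.
  by exists B => //; exact: subset_trans TB.
rewrite eq_card0 // => B; rewrite inE; apply/negP => /andP[/nB]; exact/negP.
Qed.

(** * Blow-up of a packing to every large number of points *)

Lemma blowup_factor (m n : nat) : 0 < m -> m + m * m`! <= n ->
  exists q, [/\ 1 < q, coprime q m`!, m * q <= n & n <= m * q + (m + m * m`!)].
Proof.
move=> m0 mn; have f0 := fact_gt0 m; set k := (n - m) %/ (m * m`!).
have d0 : 0 < m * m`! by rewrite muln_gt0 m0.
have k0 : 0 < k by rewrite divn_gt0 //; lia.
have k1 : k * (m * m`!) <= n - m by exact: leq_divM.
have k2 : n - m < k.+1 * (m * m`!) by exact: ltn_ceil.
(* This [q] is 1 modulo [m!], hence coprime to it; successive values of [m * q] differ by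
   [m * m!]. *)
exists (k * m`! + 1); split; [nia | | nia | nia].
by rewrite /coprime gcdnC gcdnMDl gcdn1.
Qed.

(** Keeps only the blocks of the first kind in the amplification, then rounds [n] down to a multiple
    [m * q]. *)
Lemma packing_number_blowup (i r m n : nat) : i <= r -> 0 < m -> m + m * m`! <= n ->
  (n - (m + m * m`!)) ^ i * packing_number i r m <= m ^ i * packing_number i r n.
Proof.
move=> ir m0 mn; have [q [q1 qm mq nq]] := blowup_factor m0 mn.
have pq : q ^ i * packing_number i r m <= packing_number i r (m * q).
  (* The power of ['C(m, i)] cannot be cancelled when it vanishes, but then the packing number is 0
     too. *)
  have [W0|W0] := posnP 'C(m, i).
    have := packing_number_le i r m; rewrite W0 leqn0 muln_eq0 => /orP[/eqP->|].
      by rewrite muln0.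
    by rewrite -leqn0 leqNgt bin_gt0 ir.
  have W1 : 0 < 'C(m, i) ^ 'C(r, i) by rewrite expn_gt0 W0.
  have := packing_number_amplify ir q1 qm; rewrite mulnDr => am.
  by rewrite -(leq_pmul2r W1); apply: leq_trans am; exact: leq_addr.
apply: leq_trans (leq_mul (leqnn _) (leq_trans pq (leq_packing_number ir mq))).
rewrite mulnA -expnMn leq_mul //; case: (i) => // j.
by rewrite leq_exp2r // leq_subLR addnC.
Qed.

Lemma packing_number_gt0 (i r : nat) : 0 < i -> i <= r -> 0 < packing_number i r r.
Proof.
move=> i0 ir; rewrite -(cards1 tt).
apply: (@packing_number_ge i r 'I_r _ [set tt] (fun=> [set: 'I_r])) => //.
- by rewrite card_ord.
- by move=> _ _; rewrite cardsT card_ord.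
Qed.

(** * Asymptotic density *)

Import Order.TTheory.
Local Open Scope classical_set_scope.
Local Open Scope ring_scope.

Lemma mul_bin_bin (i t r : nat) : (i <= t)%N -> (t <= r)%N ->
  ('C(r, t) * 'C(t, i) = 'C(r, i) * 'C(r - i, t - i))%N.
Proof.
move=> it tr; have ir := leq_trans it tr.
have F : (0 < i`! * (t - i)`! * (r - t)`!)%N by rewrite !muln_gt0 !fact_gt0.
apply/eqP; rewrite -(eqn_pmul2r F); apply/eqP.
have e1 := bin_fact tr; have e2 := bin_fact it; have e3 := bin_fact ir.
have e4 := bin_fact (leq_sub2r i tr).
rewrite subnBA // subnK // in e4.
transitivity ('C(r, t) * ('C(t, i) * (i`! * (t - i)`!) * (r - t)`!))%N; first ring.
rewrite e2 e1 -e3 -e4; ring.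
Qed.

Lemma cvg_near_eq (R : realType) (f g : nat -> R) (l : R) :
  f @ \oo --> l -> (\forall n \near \oo, f n = g n) -> g @ \oo --> l.
Proof. by move=> fl fg; apply: cvg_trans fl; exact: near_eq_cvg. Qed.

Lemma cvg_expr (R : realType) (f : nat -> R) (l : R) (k : nat) :
  f @ \oo --> l -> (fun n => f n ^+ k) @ \oo --> l ^+ k.
Proof.
move=> fl; elim: k => [|k IHk]; first exact: cvg_cst.
by under eq_fun do rewrite exprS; rewrite exprS; exact: cvgM.
Qed.

Section Density.
Variables (R : realType) (i r : nat).
Hypotheses (i0 : (0 < i)%N) (ir : (i <= r)%N).

Let C := 'C(r, i).

Let C0 : (0 < C)%N. Proof. by rewrite bin_gt0. Qed.

Let pn (n : nat) : R := (packing_number i r n)%:R.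

(** The normalisation by [n ^ i] suits blow-ups, which multiply it by exactly [q ^ i]. At [n = 0]
    the value is 0, by the convention on division. *)
Definition power_density (n : nat) : R := pn n / n%:R ^+ i.

Definition packing_density (n : nat) : R := pn n * C%:R / ('C(n, i))%:R.

Lemma cvg_shift_ratio (M : nat) : (fun n => (n - M)%:R / n%:R : R) @ \oo --> (1 : R).
Proof.
have H : (fun n => 1 - M%:R * n%:R^-1 : R) @ \oo --> (1 - M%:R * 0 : R).
  apply: cvgB; first exact: cvg_cst.
  by apply: cvgMr; apply/gtr0_cvgV0; [near=> n; rewrite ltr0n; near: n; exact: nbhs_infty_gt | exact: cvgr_idn].
rewrite mulr0 subr0 in H; apply: cvg_trans H; apply: near_eq_cvg.
near=> n; have Mn : (M <= n)%N by near: n; exact: nbhs_infty_ge.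
have n0 : n%:R != 0 :> R by rewrite pnatr_eq0 -lt0n; near: n; exact: nbhs_infty_gt.
by rewrite natrB // mulrBl divff.
Unshelve. all: by end_near. Qed.

Lemma cvg_bin_ratio (j : nat) :
  (fun n => ('C(n, j))%:R / n%:R ^+ j : R) @ \oo --> ((j`!)%:R^-1 : R).
Proof.
elim: j => [|j IHj].
  by under eq_fun do rewrite bin0 expr0 divr1; rewrite fact0 invr1; exact: cvg_cst.
have -> : ((j.+1)`!)%:R^-1 = (j`!)%:R^-1 * 1 * j.+1%:R^-1 :> R.
  by rewrite mulr1 -invfM -natrM factS mulnC.
have H : (fun n => 'C(n, j)%:R / n%:R ^+ j * ((n - j)%:R / n%:R) * j.+1%:R^-1 : R) @ \oo
           --> (j`!)%:R^-1 * 1 * (j.+1%:R^-1 : R).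
  by apply: cvgM (cvg_cst _); exact: cvgM IHj (cvg_shift_ratio j).
apply: (cvg_near_eq H); near=> n => /=.
have n0 : n%:R != 0 :> R by rewrite pnatr_eq0 -lt0n; near: n; exact: nbhs_infty_gt.
have nj : (n%:R : R) ^+ j != 0 by rewrite expf_neq0.
have j0 : j.+1%:R != 0 :> R by rewrite pnatr_eq0.
have := mul_bin_left n j => /(congr1 (fun k => k%:R : R)); rewrite !natrM exprS => E.
apply: (mulfI j0); rewrite [RHS]mulrA E.
field; by rewrite nj n0 addrC natr1.
Unshelve. all: by end_near. Qed.

Lemma power_density_ge0 n : 0 <= power_density n.
Proof. by rewrite divr_ge0 // exprn_ge0. Qed.

Lemma packing_density_le1 n : packing_density n <= 1.
Proof.
have [W0|W0] := posnP 'C(n, i); first by rewrite /packing_density W0 invr0 mulr0.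
by rewrite ler_pdivrMr ?ltr0n // mul1r -natrM ler_nat packing_number_le.
Qed.

Lemma power_density_le1 n : power_density n <= 1.
Proof.
have [->|n0] := posnP n; first by rewrite /power_density expr0n eqn0Ngt i0 /= invr0 mulr0.
rewrite ler_pdivrMr ?exprn_gt0 ?ltr0n // mul1r -natrX ler_nat.
apply: (@leq_trans (packing_number i r n * C)); first by rewrite leq_pmulr.
apply: leq_trans (packing_number_le i r n) _.
apply: (@leq_trans (n ^_ i)); first by rewrite -bin_ffact leq_pmulr ?fact_gt0.
by elim: (i) => // j IHj; rewrite ffactnSr expnSr leq_mul ?leq_subr.
Qed.

Let alpha : R := sup (range power_density).

Let has_sup_density : has_sup (range power_density).
Proof.
split; first by exists (power_density 0); exists 0%N.
by exists 1 => _ [n _ <-]; exact: power_density_le1.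
Qed.

Lemma power_density_le_sup n : power_density n <= alpha.
Proof. by apply: (sup_upper_bound has_sup_density); exists n. Qed.

Lemma sup_density_gt0 : 0 < alpha.
Proof.
apply: lt_le_trans (power_density_le_sup r).
by rewrite divr_gt0 ?exprn_gt0 ?ltr0n ?packing_number_gt0 // (leq_trans i0).
Qed.

(** A Fekete-type argument: a nearly optimal [m], blown up, gives almost its density at every large
    [n]. *)
Lemma cvg_power_density : power_density @ \oo --> alpha.
Proof.
apply/cvgrPdist_lt => e e0.
have [_ [m _ <-] em] := sup_adherent e0 has_sup_density.
rewrite -/alpha in em.
(* The density at 0 is 0, so a near-optimal [m = 0] means [alpha < e]. *)
have [m0|m0] := posnP m.
  near=> n; rewrite ger0_norm ?subr_ge0 ?power_density_le_sup //.
  have : alpha < e by move: em; rewrite m0 /power_density expr0n eqn0Ngt i0 /= invr0 mulr0 subr_lt0.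
  by have := power_density_ge0 n; lra.
pose M := (m + m * m`!)%N.
have H : (fun n => power_density m * ((n - M)%:R / n%:R) ^+ i : R) @ \oo
           --> power_density m * 1 ^+ i.
  apply: cvgM (cvg_cst _) _; exact: cvg_expr (cvg_shift_ratio M).
rewrite expr1n mulr1 in H.
near=> n; rewrite ger0_norm ?subr_ge0 ?power_density_le_sup //.
have h1 : alpha - e < power_density m * ((n - M)%:R / n%:R) ^+ i.
  by near: n; apply: (cvgr_gt _ H).
have n0 : (0 < n)%N by near: n; exact: nbhs_infty_gt.
have Mn : (M <= n)%N by near: n; exact: nbhs_infty_ge.
have h2 : power_density m * ((n - M)%:R / n%:R) ^+ i <= power_density n.
  rewrite /power_density ler_pdivlMr ?exprn_gt0 ?ltr0n // expr_div_n mulrA divfK ?expf_neq0 ?pnatr_eq0 -?lt0n //.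
  rewrite mulrAC ler_pdivrMr ?exprn_gt0 ?ltr0n // -!natrX -!natrM ler_nat mulnC [leqRHS]mulnC.
  exact: packing_number_blowup.
lra.
Unshelve. all: by end_near. Qed.

Lemma cvg_packing_density : packing_density @ \oo --> alpha * C%:R * (i`!)%:R.
Proof.
have f0 : ((i`!)%:R^-1 : R) != 0 by rewrite invr_eq0 pnatr_eq0 -lt0n fact_gt0.
have H : (fun n => power_density n * C%:R * ('C(n, i)%:R / n%:R ^+ i)^-1) @ \oo
           --> alpha * C%:R * (i`!)%:R^-1^-1.
  apply: cvgM; first exact: cvgM cvg_power_density (cvg_cst _).
  apply: (@cvgV R nat \oo _ (fun n => ('C(n, i))%:R / n%:R ^+ i : R) _ f0).
  exact: cvg_bin_ratio.
rewrite invrK in H; apply: (cvg_near_eq H); near=> n => /=.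
have n0 : n%:R != 0 :> R by rewrite pnatr_eq0 -lt0n; near: n; exact: nbhs_infty_gt.
have ni : (n%:R : R) ^+ i != 0 by rewrite expf_neq0.
have b0 : ('C(n, i))%:R != 0 :> R.
  by rewrite pnatr_eq0 -lt0n bin_gt0; near: n; exact: nbhs_infty_ge.
rewrite /packing_density /power_density; field; exact/andP.
Unshelve. all: by end_near. Qed.

(** One amplification, with [q = m! + 1], stays below the supremum; [i <= m] makes ['C(m, i)]
    invertible. *)
Lemma power_density_amplify m : (i <= m)%N ->
  power_density m * (1 + (1 - packing_density m) ^+ C) <= alpha.
Proof.
move=> im; have m0 : (0 < m)%N by exact: leq_trans im.
set q := (m`!).+1; have q1 : (1 < q)%N by rewrite ltnS fact_gt0.
have qm : coprime q m`! by rewrite coprime_sym coprimenS.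
apply: le_trans (power_density_le_sup (m * q)).
have W0 : (0 < ('C(m, i))%:R :> R)%R by rewrite ltr0n bin_gt0.
have := packing_number_amplify ir q1 qm.
rewrite -(ler_nat R) !natrM natrD !natrX natrB ?packing_number_le // natrM -/(pn m) -/(pn _) -/C => am.
have q0 : (0 : R) < q%:R by rewrite ltr0n.
have mR : (0 : R) < m%:R by rewrite ltr0n.
rewrite /power_density natrM exprMn ler_pdivlMr ?mulr_gt0 ?exprn_gt0 //.
have -> : 1 - packing_density m = ('C(m, i)%:R - pn m * C%:R) / 'C(m, i)%:R.
  by rewrite /packing_density mulrBl divff // gt_eqF.
rewrite expr_div_n -(ler_pM2r (exprn_gt0 C W0)); apply: le_trans am.
have WC : ('C(m, i)%:R : R) ^+ C != 0 by rewrite expf_neq0 // gt_eqF.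
have mi : (m%:R : R) ^+ i != 0 by rewrite expf_neq0 // gt_eqF.
rewrite le_eqVlt; apply/orP; left; apply/eqP; field; exact/andP.
Qed.

Lemma packing_density_cvg1 : packing_density @ \oo --> (1 : R).
Proof.
set beta := alpha * C%:R * (i`!)%:R; have Hb := cvg_packing_density.
have b1 : beta <= 1.
  by apply: (cvgr_to_le Hb); near=> n; exact: packing_density_le1.
have H : (fun n => power_density n * (1 + (1 - packing_density n) ^+ C)) @ \oo
           --> alpha * (1 + (1 - beta) ^+ C).
  apply: cvgM; first exact: cvg_power_density.
  apply: cvgD; first exact: cvg_cst.
  have Hs : (fun n => 1 - packing_density n) @ \oo --> 1 - beta.
    by apply: cvgB => //; exact: cvg_cst.
  exact: cvg_expr Hs.
have : alpha * (1 + (1 - beta) ^+ C) <= alpha.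
  apply: (cvgr_to_le H); near=> n; apply: power_density_amplify.
  near: n; exact: nbhs_infty_ge.
(* Cancelling [alpha > 0] leaves [(1 - beta) ^+ C <= 0]; with [beta <= 1] and [C > 0] this forces
   [beta = 1]. *)
rewrite -[leRHS]mulr1 ler_pM2l ?sup_density_gt0 // -subr_ge0 opprD addrA subrr add0r oppr_ge0 => bC.
have : (1 - beta) ^+ C == 0 by rewrite eq_le bC exprn_ge0 // subr_ge0.
rewrite expf_eq0 C0 /= subr_eq0 => /eqP be.
by rewrite [X in _ --> X]be.
Unshelve. all: by end_near. Qed.

End Density.

(** The [1 - o(1)] factor is the ratio tending to 1; it is squeezed between the packing density and
    1. *)
Theorem mainTheorem16 (R : realType) (i s t r : nat) :
  (1 <= i)%N -> (i < s)%N -> (s <= t)%N -> (t <= r)%N ->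
  (fun n : nat => (Nmax i s t r n)%:R /
     (('C(n, i))%:R / ('C(r, i))%:R * ('C(r, t))%:R) : R) @ \oo --> (1 : R).
Proof.
move=> i0 lis st tr.
have it : (i <= t)%N by lia.
have ir : (i <= r)%N by lia.
suff bounds : \forall n \near \oo, packing_density R i r n <=
    (Nmax i s t r n)%:R / (('C(n, i))%:R / ('C(r, i))%:R * ('C(r, t))%:R) <= (1 : R).
  by apply: (squeeze_cvgr bounds); [exact: packing_density_cvg1 | exact: cvg_cst].
near=> n.
have W0 : (0 : R) < ('C(n, i))%:R.
  by rewrite ltr0n bin_gt0; near: n; exact: nbhs_infty_ge.
have C0 : (0 : R) < ('C(r, i))%:R by rewrite ltr0n bin_gt0.
have T0 : (0 : R) < ('C(r, t))%:R by rewrite ltr0n bin_gt0.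
have D0 : (0 : R) < ('C(t, i))%:R by rewrite ltr0n bin_gt0.
have lo := Nmax_lower r n lis st.
have up := Nmax_upper n lis st tr.
rewrite -(ler_nat R) natrM in lo; rewrite -(ler_nat R) !natrM in up.
have bb : ('C(r, t))%:R * ('C(t, i))%:R = ('C(r, i))%:R * ('C(r - i, t - i))%:R :> R.
  by rewrite -!natrM mul_bin_bin.
have Q0 : (0 : R) < ('C(n, i))%:R / ('C(r, i))%:R * ('C(r, t))%:R.
  by apply: mulr_gt0 => //; exact: divr_gt0.
apply/andP; split.
  rewrite /packing_density ler_pdivlMr //.
  apply: le_trans lo; rewrite le_eqVlt; apply/orP; left; apply/eqP.
  by field; rewrite !gt_eqF.
(* Multiplying by ['C(t, i)] lets [bb] turn the target into the bound of [Nmax_upper]. *)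
rewrite ler_pdivrMr // mul1r -(ler_pM2r D0).
apply: le_trans up _; rewrite -[leRHS]mulrA bb le_eqVlt; apply/orP; left; apply/eqP.
by field; rewrite gt_eqF.
Unshelve. all: by end_near. Qed.
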